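(* Let $W$ be a finite Coxeter group with standard Coxeter element $c$ and $c$-compatible reflection ordering $\prec$. The quadratic dual $\mathcal{P}=\mathcal{A}^!$ of $\mathcal{A}=k[\mathbf{D}(W)]$ is $\mathcal{P}=\mathcal{T}(k^{\{x_t:t\in T\}})/\langle R^\perp\rangle$, where $x_t$ is the basis dual to $(\mathbf{t})_{t\in T}$ and $R^\perp$ is spanned by: (1) $x_t\otimes x_t$ for $t\in T$; (2) $x_t\otimes x_u$ for $t,u\in T$ with $tu\not\le_T c$; (3) $x_{u_1}\otimes x_{u_m}+x_{u_m}\otimes x_{u_{m-1}}+\cdots+x_{u_2}\otimes x_{u_1}$ for each $w\in NC_2$, where $\{t\in T: t\le_T w\}=\{u_1\prec\dots\prec u_m\}$.
   Context: $T$ is the set of reflections of $W$; $t^u=u^{-1}tu$; $\ell_T$ is reflection length, $w\le_T z$ iff $\ell_T(w)+\ell_T(w^{-1}z)=\ell_T(z)$; $NC=[e,c]$ in this order and $NC_2$ its elements of length 2. $\mathbf{D}(W)$ has generators $\mathbf{t}$ ($t\in T$) and relations $\mathbf{t}\mathbf{u}=\mathbf{u}\mathbf{t}^{\mathbf{u}}$ whenever $tu\le_T c$, so $\mathcal{A}=\mathcal{T}(k^{\mathbf{T}})/\langle R\rangle$ with $R$ spanned by $\mathbf{t}\otimes\mathbf{u}-\mathbf{u}\otimes\mathbf{t}^{\mathbf{u}}$, and $\mathcal{A}^!=\mathcal{T}((k^{\mathbf{T}})^* )/\langle R^\perp\rangle$. A reflection ordering is a total order on $T$ such that for each rank 2 parabolic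 subgroup, with reflections $u_1,\dots,u_m$ indexed so that $u_{i+1}u_i=u_iu_{i-1}$ (indices mod $m$) and $u_1,u_m$ simple, they appear in the order $u_1,\dots,u_m$ or its reverse; it is $c$-compatible if for each $w\in NC_2$ with $\{t\le_T w\}=\{u_1\prec\dots\prec u_m\}$, $w=u_iu_{i-1}$ for all $i$ ($u_0=u_m$). *)

(* Defs.v *)
From HB Require Import structures.
From mathcomp Require Import all_boot all_order all_fingroup all_algebra.
From mathcomp Require Import generic_quotient.
From mathcomp Require Import boolp finmap.
From mathcomp.multinomials Require Import monalg.

Set Implicit Arguments.
Unset Strict Implicit.
Unset Printing Implicit Defensive.

Import GRing.Theory.
Local Open Scope ring_scope.

Section Ideals.
Variables (k : fieldType) (A : algType k).

Definition two_sided_ideal (J : A -> Prop) : Prop :=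
  [/\ J 0, forall x y, J x -> J y -> J (x + y)
    & forall a x b, J x -> J (a * x * b)].

Definition ideal_gen (E : A -> Prop) (a : A) : Prop :=
  forall J, two_sided_ideal J -> (forall e, E e -> J e) -> J a.

Lemma ideal_gen_ideal E : two_sided_ideal (ideal_gen E).
Proof.
split=> [J []//|x y Ex Ey J JI JE|a x b Ex J JI JE]; case: (JI) => _ JD JM.
- by apply: JD; [apply: Ex | apply: Ey].
- by apply: JM; apply: Ex.
Qed.

Lemma mem_ideal_gen (E : A -> Prop) e : E e -> ideal_gen E e.
Proof. by move=> Ee J _; apply. Qed.

(* Properness is required because the rings underlying [algType] are
   nontrivial. *)
Record proper_ideal := ProperIdeal {
  pideal :> A -> Prop;
  pideal_ideal : two_sided_ideal pideal;
  pideal_proper : ~ pideal 1 }.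

Definition pideal_mem (I : proper_ideal) : {pred A} := [pred a | `[< I a >]].

Fact pideal_zmod_closed I : zmod_closed (pideal_mem I).
Proof.
have [I0 ID IM] := pideal_ideal I; split=> [|x y /asboolP Ix /asboolP Iy].
  exact/asboolP.
apply/asboolP; apply: ID => //.
by have := IM (- 1) _ 1 Iy; rewrite mulN1r mulr1.
Qed.

HB.instance Definition _ I :=
  GRing.isZmodClosed.Build A (pideal_mem I) (pideal_zmod_closed I).

End Ideals.

Section AlgebraQuotient.
Local Open Scope quotient_scope.
Variables (k : fieldType) (A : algType k) (I : proper_ideal A).

Definition alg_quot := Quotient.quot (pideal_mem I).

HB.instance Definition _ := GRing.Zmodule.on alg_quot.

Definition alg_pi (a : A) : alg_quot := \pi_alg_quot a.

Lemma alg_piP a b : (alg_pi a = alg_pi b) <-> I (a - b).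
Proof.
split=> [/eqP|Iab]; [|apply/eqP]; rewrite -Quotient.idealrBE;
  [by move/asboolP | exact/asboolP].
Qed.

Lemma alg_pi_surj (x : alg_quot) : exists a, alg_pi a = x.
Proof. by exists (repr x); rewrite /alg_pi reprK. Qed.

Fact alg_piB : zmod_morphism alg_pi.
Proof. by move=> a b; rewrite /alg_pi raddfB. Qed.

HB.instance Definition _ :=
  GRing.isZmodMorphism.Build A alg_quot alg_pi alg_piB.

Definition quot_mul (x y : alg_quot) : alg_quot := alg_pi (repr x * repr y).
Definition quot_scale (c : k) (x : alg_quot) : alg_quot := alg_pi (c *: repr x).

Lemma alg_pi_repr x : alg_pi (repr x) = x.
Proof. by rewrite /alg_pi reprK. Qed.

Lemma alg_pi_mul a b : alg_pi (a * b) = quot_mul (alg_pi a) (alg_pi b).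
Proof.
have [_ ID IM] := pideal_ideal I.
set a' := repr (alg_pi a); set b' := repr (alg_pi b).
have Ia : I (a - a') by apply/alg_piP; rewrite alg_pi_repr.
have Ib : I (b - b') by apply/alg_piP; rewrite alg_pi_repr.
apply/alg_piP.
have -> : a * b - a' * b' = (1 * (a - a') * b) + (a' * (b - b') * 1).
  by rewrite mul1r mulr1 mulrBl mulrBr addrA subrK.
by apply: ID; apply: IM.
Qed.

Lemma alg_pi_scale c a : alg_pi (c *: a) = quot_scale c (alg_pi a).
Proof.
have [_ ID IM] := pideal_ideal I.
apply/alg_piP; rewrite -scalerBr.
have := IM c%:A (a - repr (alg_pi a)) 1; rewrite mulr1 -scalerAl mul1r; apply.
by apply/alg_piP; rewrite alg_pi_repr.
Qed.

Fact quot_mulA : associative quot_mul.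
Proof.
by move=> x y z; rewrite -[x]alg_pi_repr -[y]alg_pi_repr -[z]alg_pi_repr
  -!alg_pi_mul mulrA.
Qed.
Fact quot_mul1l : left_id (alg_pi 1) quot_mul.
Proof. by move=> x; rewrite -[x]alg_pi_repr -alg_pi_mul mul1r. Qed.
Fact quot_mul1r : right_id (alg_pi 1) quot_mul.
Proof. by move=> x; rewrite -[x]alg_pi_repr -alg_pi_mul mulr1. Qed.
Fact quot_mulDl : left_distributive quot_mul +%R.
Proof.
by move=> x y z; rewrite -[x]alg_pi_repr -[y]alg_pi_repr -[z]alg_pi_repr
  -raddfD -!alg_pi_mul mulrDl raddfD.
Qed.
Fact quot_mulDr : right_distributive quot_mul +%R.
Proof.
by move=> x y z; rewrite -[x]alg_pi_repr -[y]alg_pi_repr -[z]alg_pi_repr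
  -raddfD -!alg_pi_mul mulrDr raddfD.
Qed.
Fact quot_1neq0 : alg_pi 1 != 0.
Proof.
apply/eqP; rewrite -[0](raddf0 alg_pi) => /alg_piP; rewrite subr0.
exact: pideal_proper.
Qed.

HB.instance Definition _ := GRing.Zmodule_isNzRing.Build alg_quot
  quot_mulA quot_mul1l quot_mul1r quot_mulDl quot_mulDr quot_1neq0.

Fact quot_scaleA a b x : quot_scale a (quot_scale b x) = quot_scale (a * b) x.
Proof. by rewrite -[x]alg_pi_repr -!alg_pi_scale scalerA. Qed.
Fact quot_scale1 : left_id 1 quot_scale.
Proof. by move=> x; rewrite -[x]alg_pi_repr -alg_pi_scale scale1r. Qed.
Fact quot_scaleDr : right_distributive quot_scale +%R.
Proof.
by move=> c x y; rewrite -[x]alg_pi_repr -[y]alg_pi_repr -raddfD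
  -!alg_pi_scale scalerDr raddfD.
Qed.
Fact quot_scaleDl x : {morph quot_scale^~ x : a b / a + b}.
Proof.
by move=> a b /=; rewrite -[x]alg_pi_repr -!alg_pi_scale scalerDl raddfD.
Qed.

HB.instance Definition _ := GRing.Zmodule_isLmodule.Build k alg_quot
  quot_scaleA quot_scale1 quot_scaleDr quot_scaleDl.

Fact quot_scaleAl (c : k) (x y : alg_quot) : c *: (x * y) = c *: x * y.
Proof.
rewrite -[x]alg_pi_repr -[y]alg_pi_repr -[LHS]/(quot_scale _ (quot_mul _ _)).
rewrite -[RHS]/(quot_mul (quot_scale _ _) _).
by rewrite -!(alg_pi_mul, alg_pi_scale) scalerAl.
Qed.

HB.instance Definition _ :=
  GRing.Lmodule_isLalgebra.Build k alg_quot quot_scaleAl.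

Fact quot_scaleAr (c : k) (x y : alg_quot) : c *: (x * y) = x * (c *: y).
Proof.
rewrite -[x]alg_pi_repr -[y]alg_pi_repr -[LHS]/(quot_scale _ (quot_mul _ _)).
rewrite -[RHS]/(quot_mul _ (quot_scale _ _)).
by rewrite -!(alg_pi_mul, alg_pi_scale) scalerAr.
Qed.

HB.instance Definition _ :=
  GRing.Lalgebra_isAlgebra.Build k alg_quot quot_scaleAr.

Fact alg_pi_monoid_morphism : monoid_morphism alg_pi.
Proof. by split=> // a b; rewrite alg_pi_mul. Qed.

HB.instance Definition _ :=
  GRing.isMonoidMorphism.Build A alg_quot alg_pi alg_pi_monoid_morphism.

Fact alg_pi_scalable : scalable alg_pi.
Proof. by move=> c a; rewrite alg_pi_scale. Qed.

HB.instance Definition _ :=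
  GRing.isScalable.Build k A alg_quot *:%R alg_pi alg_pi_scalable.

Lemma alg_pi_eq0 a : alg_pi a = 0 <-> I a.
Proof. by rewrite -[0](raddf0 alg_pi) alg_piP subr0. Qed.

End AlgebraQuotient.

(* An alias of [malg]: the library gives [{malg k[M]}] an [algType] structure
   only when M is commutative. *)
Definition monoid_algebra (k : fieldType) (M : monomType) := {malg k[M]}.

Lemma malgZU (k : fieldType) (M : monomType) (c : k) (m : M) :
  c *: (<< m >> : {malg k[M]}) = << c *g m >>.
Proof. by apply/malgP => n; rewrite mcoeffZ mcoeffU1 mcoeffU mulr_natr. Qed.

Lemma malgUM (k : fieldType) (M : monomType) (m n : M) :
  (<< m >> : {malg k[M]}) * << n >> = << mmul m n >>.
Proof. by rewrite [LHS]fgmulUU mulr1. Qed.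

Section MonoidAlgebra.
Variables (k : fieldType) (M : monomType).

HB.instance Definition _ := GRing.Lalgebra.on (monoid_algebra k M).

Fact monoid_algebra_scaleAr (c : k) (x y : monoid_algebra k M) :
  c *: (x * y) = x * (c *: y).
Proof.
apply/malgP => m; rewrite mcoeffZ (mcoeffMlw m (fsubset_refl (msupp x)) (msuppZ_le _ _)).
rewrite mcoeffMl mulr_sumr; apply: eq_bigr => i _; rewrite mulr_sumr.
by apply: eq_bigr => j _; rewrite mcoeffZ mulrCA mulrnAr.
Qed.

HB.instance Definition _ :=
  GRing.Lalgebra_isAlgebra.Build k (monoid_algebra k M) monoid_algebra_scaleAr.

End MonoidAlgebra.

Section TensorAlgebra.
Variables (k : fieldType) (X : finType).

(* The space k^X has basis X, so its tensor algebra has basis the words in X. *)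
Definition tensor_algebra : algType k := monoid_algebra k {fmonom X}.

Definition tens_gen (x : X) : tensor_algebra := << fmu x >>.

Section Lift.
Variables (A : algType k) (f : X -> A).

Definition word_val (w : {fmonom X}) : A := \prod_(x <- (w : seq X)) f x.

Fact word_val_morphism : mmorphism word_val.
Proof.
by split=> [u v|]; rewrite /word_val ?fmM ?fm1 ?big_cat ?big_nil.
Qed.

HB.instance Definition _ :=
  isMultiplicative.Build {fmonom X} A word_val word_val_morphism.

Definition tens_lift (a : tensor_algebra) : A := mmap (in_alg A) word_val a.

Fact tens_lift_zmod_morphism : zmod_morphism tens_lift.
Proof. by move=> a b; rewrite /tens_lift raddfB. Qed.

HB.instance Definition _ :=
  GRing.isZmodMorphism.Build tensor_algebra A tens_lift tens_lift_zmod_morphism.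

Fact tens_lift_monoid_morphism : monoid_morphism tens_lift.
Proof.
have [M U] : multiplicative (mmap (in_alg A) word_val).
  apply: commr_mmap_is_multiplicative => g m m'.
  by rewrite /GRing.comm /= -scalerAl mul1r -scalerAr mulr1.
by split=> [|a b]; [exact: U | exact: M].
Qed.

HB.instance Definition _ := GRing.isMonoidMorphism.Build tensor_algebra A
  tens_lift tens_lift_monoid_morphism.

Fact tens_lift_scalable : scalable tens_lift.
Proof. by move=> c a; rewrite /tens_lift mmapZ /= -scalerAl mul1r. Qed.

HB.instance Definition _ := GRing.isScalable.Build k tensor_algebra A *:%R
  tens_lift tens_lift_scalable.

Lemma tens_lift_word (w : {fmonom X}) : tens_lift << w >> = word_val w.
Proof. by rewrite /tens_lift mmapU /= scale1r mul1r. Qed.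

Lemma tens_lift_gen x : tens_lift (tens_gen x) = f x.
Proof. by rewrite tens_lift_word /word_val fmU big_seq1. Qed.

End Lift.

Lemma tens_word (w : {fmonom X}) :
  << w >> = \prod_(x <- (w : seq X)) tens_gen x :> tensor_algebra.
Proof.
case: w => s /=; elim: s => [|x s IHs].
  by rewrite big_nil -[RHS]/(<< fmone X >>) fmoneE.
rewrite big_cons -IHs /tens_gen [RHS]fgmulUU mulr1; congr << _ >>.
by apply/eqP; rewrite fmP fmM fmU.
Qed.

Lemma tens_cat (u v : seq X) :
  << FMonom (u ++ v) >>
    = << FMonom u >> * << FMonom v >> :> tensor_algebra.
Proof.
rewrite [RHS]malgUM; congr << _ >>.
by apply/eqP; rewrite fmP fmM.
Qed.

Lemma tens_expand (a : tensor_algebra) :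
  a = \sum_(w <- msupp a) (a@_w) *: (<< w >> : tensor_algebra).
Proof.
rewrite {1}[a]monalgE; apply: eq_bigr => w _.
exact: (esym (malgZU _ _)).
Qed.

Lemma tens_lift_unique (A : algType k) (g : {lrmorphism tensor_algebra -> A}) :
  g =1 tens_lift (g \o tens_gen).
Proof.
move=> a; rewrite [a in LHS]tens_expand [a in RHS]tens_expand !linear_sum.
apply: eq_bigr => w _; rewrite !linearZ /= tens_lift_word tens_word rmorph_prod.
by [].
Qed.

End TensorAlgebra.

Section QuadraticData.
Variables (k : fieldType) (X : finType).

Definition vec : vectType k := {ffun X -> k^o}.
(* The tensor square of k^X, in its basis of tensors x (x) y. *)
Definition tensor2 : vectType k := {ffun X * X -> k^o}.

Definition basis_vec (x : X) : vec := [ffun y => (y == x)%:R].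
Definition tensor (v w : vec) : tensor2 := [ffun p => v p.1 * w p.2].
Definition basis_tensor (x y : X) : tensor2 :=
  tensor (basis_vec x) (basis_vec y).

Definition tensor2_embed (r : tensor2) : tensor_algebra k X :=
  \sum_(p : X * X) r p *: (tens_gen k p.1 * tens_gen k p.2).

Definition quad_ideal (R : {vspace tensor2}) : tensor_algebra k X -> Prop :=
  ideal_gen (fun a => exists2 r, r \in R & a = tensor2_embed r).

(* The dual of k^X is identified with k^X through the basis dual to X, so the
   evaluation pairings are the standard ones. *)
Definition pairing1 (f v : vec) : k := \sum_(x : X) f x * v x.
Definition pairing2 (f r : tensor2) : k := \sum_(p : X * X) f p * r p.

Lemma pairing1_basis x y : pairing1 (basis_vec x) (basis_vec y) = (x == y)%:R.
Proof.
rewrite /pairing1 (bigD1 x) //= !ffunE eqxx mul1r big1 ?addr0 // => z /negPf zx.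
by rewrite ffunE zx mul0r.
Qed.

Lemma pairing2_tensor f g v w :
  pairing2 (tensor f g) (tensor v w) = pairing1 f v * pairing1 g w.
Proof.
rewrite /pairing2 /pairing1 big_distrlr /= pair_bigA /=.
by apply: eq_bigr => p _; rewrite !ffunE mulrACA.
Qed.

Definition pair_with (r f : tensor2) : k^o := pairing2 f r.

Fact pair_with_is_linear r : linear (pair_with r).
Proof.
move=> c f g; rewrite /pair_with /pairing2 scaler_sumr -big_split /=.
by apply: eq_bigr => p _; rewrite !ffunE mulrDl -[c *: f p]/(c * f p) -mulrA.
Qed.

HB.instance Definition _ r := GRing.isLinear.Build k tensor2 k^o _
  (pair_with r) (pair_with_is_linear r).

Fact pairing2_is_linear_r f : linear ((pairing2 f) : tensor2 -> k^o).
Proof.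
move=> c r s; rewrite /pairing2 scaler_sumr -big_split /=.
apply: eq_bigr => p _; rewrite !ffunE mulrDr.
by rewrite -[c *: r p]/(c * r p) mulrCA.
Qed.

HB.instance Definition _ f := GRing.isLinear.Build k tensor2 k^o _
  (pairing2 f) (pairing2_is_linear_r f).

Definition perp (R : {vspace tensor2}) : {vspace tensor2} :=
  (\bigcap_(r <- vbasis R) lker (linfun (pair_with r)))%VS.

Lemma perpP (R : {vspace tensor2}) f :
  f \in perp R <-> forall r, r \in R -> pairing2 f r = 0.
Proof.
rewrite /perp; have -> : (f \in (\bigcap_(r <- vbasis R)
    lker (linfun (pair_with r)))%VS)
  = all (fun r => pairing2 f r == 0) (vbasis R).
  elim: (tval (vbasis R)) => [|r s IHs]; first by rewrite big_nil memvf.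
  by rewrite big_cons memv_cap IHs memv_ker lfunE.
split=> [/allP fR r Rr|fR]; last first.
  by apply/allP => r /vbasis_mem /fR ->.
rewrite (coord_vbasis Rr) linear_sum big1 // => i _; rewrite linearZ /=.
have /eqP -> : pairing2 f (vbasis R)`_i == 0.
  by apply: fR; apply: mem_nth; rewrite size_tuple.
exact: mulr0.
Qed.

Lemma tensor2_embed_linear : linear tensor2_embed.
Proof.
move=> c r s; rewrite /tensor2_embed scaler_sumr -big_split /=.
by apply: eq_bigr => p _; rewrite !ffunE scalerDl scalerA.
Qed.

HB.instance Definition _ := GRing.isLinear.Build k tensor2 _ _
  tensor2_embed tensor2_embed_linear.

Lemma tensor2_embed_basis x y :
  tensor2_embed (basis_tensor x y) = tens_gen k x * tens_gen k y.
Proof.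
rewrite /tensor2_embed (bigD1 (x, y)) //= !ffunE !eqxx mulr1 scale1r.
rewrite big1 ?addr0 // => -[a b] /=; rewrite !ffunE /= xpair_eqE.
by case: eqP => _; case: eqP => _ //; rewrite ?(mul0r, mulr0) scale0r.
Qed.

(* The augmentation sends every generator to 0, so it kills the relations. *)
Lemma quad_ideal_proper R : ~ quad_ideal R 1.
Proof.
pose aug := tens_lift (fun _ : X => 0 : k^o).
suff : forall a, quad_ideal R a -> aug a = 0.
  by move=> H /H/eqP; rewrite /aug rmorph1 oner_eq0.
move=> a /(_ (fun a => aug a = 0)); apply=> [|_ [r _ ->]].
  rewrite /aug; split=> [|x y x0 y0|x y z y0]; first exact: rmorph0.
    by rewrite rmorphD /= x0 y0 addr0.
  by rewrite !rmorphM /= y0 mulr0 mul0r.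
rewrite /aug /tensor2_embed linear_sum big1 // => p _.
by rewrite linearZ /= rmorphM /= tens_lift_gen mul0r scaler0.
Qed.

Definition quad_pideal R : proper_ideal (tensor_algebra k X) :=
  ProperIdeal (ideal_gen_ideal _) (@quad_ideal_proper R).

Definition presented_by (A : algType k) (gen : X -> A) (R : {vspace tensor2})
    : Prop :=
  (forall b, exists a, tens_lift gen a = b) /\
  (forall a, tens_lift gen a = 0 <-> quad_ideal R a).

Definition quad_quot (R : {vspace tensor2}) : algType k :=
  alg_quot (quad_pideal R).

Definition quad_quot_gen R (x : X) : quad_quot R := alg_pi _ (tens_gen k x).

Lemma quad_quot_lift R a :
  tens_lift (@quad_quot_gen R) a = alg_pi (quad_pideal R) a.
Proof.
exact/esym/(tens_lift_unique (alg_pi (quad_pideal R))).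
Qed.

Lemma quad_quot_presented R : presented_by (@quad_quot_gen R) R.
Proof.
split=> [b|a]; last by rewrite quad_quot_lift; apply: alg_pi_eq0.
by have [a <-] := alg_pi_surj b; exists a; rewrite quad_quot_lift.
Qed.

End QuadraticData.

Arguments basis_tensor k {X} x y.

Lemma tens_lift_embed_rel (k : fieldType) (X : finType) (A : algType k)
    (f : X -> A) (p q : X * X) :
  tens_lift f (tensor2_embed (basis_tensor k p.1 p.2 - basis_tensor k q.1 q.2))
    = f p.1 * f p.2 - f q.1 * f q.2.
Proof.
have genM x y : tens_lift f (tens_gen k x * tens_gen k y) = f x * f y.
  by apply: (etrans (rmorphM (tens_lift f) _ _)); rewrite /= !tens_lift_gen.
rewrite [tensor2_embed _]linearB [LHS]linearB /= !tensor2_embed_basis.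
by congr (_ - _); apply: genM.
Qed.

Record quadratic_algebra (k : fieldType) := QuadraticAlgebra {
  qindex : finType;
  qrels : {vspace tensor2 k qindex};
  qalg :> algType k;
  qgen : qindex -> qalg;
  qpresented : presented_by qgen qrels }.

(* The index x of the dual stands for the element of the dual basis attached
   to the generator x. *)
Definition quadratic_dual (k : fieldType) (A : quadratic_algebra k) :
    quadratic_algebra k :=
  QuadraticAlgebra (quad_quot_presented (perp (qrels A))).

Section QuadraticMonoid.
Local Open Scope quotient_scope.
Variables (X : finType) (P : {pred X * X}) (phi : X * X -> X * X).

(* The congruence on words generated by xy = zt for (x, y) in P and
   (z, t) = phi (x, y). *)
Inductive word_cong : seq X -> seq X -> Prop :=
| WordCongRel u p v : p \in P ->
    word_cong (u ++ [:: p.1; p.2] ++ v) (u ++ [:: (phi p).1; (phi p).2] ++ v)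
| WordCongRefl u : word_cong u u
| WordCongSym u v : word_cong u v -> word_cong v u
| WordCongTrans v u w : word_cong u v -> word_cong v w -> word_cong u w.

Definition word_congb : rel (seq X) := fun u v => `[< word_cong u v >].

Fact word_congb_equiv : equiv_class_of word_congb.
Proof.
split=> [u|u v|v u w]; first exact/asboolP/WordCongRefl.
  by apply/asboolP/asboolP => /WordCongSym.
by move=> /asboolP uv /asboolP vw; apply/asboolP/(WordCongTrans uv).
Qed.

Canonical word_congb_equiv_rel := EquivRelPack word_congb_equiv.

Definition quad_monoid := {eq_quot word_congb}.

HB.instance Definition _ := Choice.on quad_monoid.

Definition word_class (u : seq X) : quad_monoid := \pi_quad_monoid u.

Lemma word_classP u v : word_class u = word_class v <-> word_cong u v.
Proof.
split=> [/eqP|uv]; [|apply/eqP]; rewrite /word_class eqquotE;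
  [by move/asboolP | exact/asboolP].
Qed.

Lemma word_class_repr m : word_class (repr m) = m.
Proof. by rewrite /word_class reprK. Qed.

Lemma word_cong_cat u u' v v' :
  word_cong u u' -> word_cong v v' -> word_cong (u ++ v) (u' ++ v').
Proof.
move=> uu' vv'; apply: (@WordCongTrans (u' ++ v)).
  elim: uu' => {u u' v' vv'} [u p w Pp|u|u w _|w u x _ uw _ wx].
  - by rewrite -!catA; apply: WordCongRel.
  - exact: WordCongRefl.
  - exact: WordCongSym.
  - exact: WordCongTrans uw wx.
elim: vv' => {u uu' v v'} [u p w Pp|u|u w _|w u x _ uw _ wx].
- by rewrite !(catA u' u); apply: WordCongRel.
- exact: WordCongRefl.
- exact: WordCongSym.
- exact: WordCongTrans uw wx.
Qed.

Lemma word_cong_size u v : word_cong u v -> size u = size v.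
Proof. by elim=> {u v} [u p v _|u|u v _ ->|v u w _ -> _ ->] //; rewrite !size_cat. Qed.

Definition quad_monoid_mul (m n : quad_monoid) : quad_monoid :=
  word_class (repr m ++ repr n).

Lemma word_class_cat u v :
  word_class (u ++ v) = quad_monoid_mul (word_class u) (word_class v).
Proof.
by apply/word_classP/word_cong_cat; apply/word_classP; rewrite word_class_repr.
Qed.

Fact quad_monoid_mulA : associative quad_monoid_mul.
Proof.
by move=> x y z; rewrite -[x]word_class_repr -[y]word_class_repr
  -[z]word_class_repr -!word_class_cat catA.
Qed.
Fact quad_monoid_mul1l : left_id (word_class [::]) quad_monoid_mul.
Proof. by move=> x; rewrite -[x]word_class_repr -word_class_cat. Qed.
Fact quad_monoid_mul1r : right_id (word_class [::]) quad_monoid_mul.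
Proof. by move=> x; rewrite -[x]word_class_repr -word_class_cat cats0. Qed.
Fact quad_monoid_unit (x y : quad_monoid) :
  quad_monoid_mul x y = word_class [::] ->
  x = word_class [::] /\ y = word_class [::].
Proof.
move/word_classP/word_cong_size/eqP; rewrite size_cat addn_eq0 !size_eq0.
case/andP => /eqP ex /eqP ey.
by split; [rewrite -[LHS]word_class_repr ex | rewrite -[LHS]word_class_repr ey].
Qed.

HB.instance Definition _ := Choice_isMonomialDef.Build quad_monoid
  quad_monoid_mulA quad_monoid_mul1l quad_monoid_mul1r quad_monoid_unit.

Variable k : fieldType.

Definition quad_monoid_gen (x : X) : monoid_algebra k quad_monoid :=
  << word_class [:: x] >>.

Definition quad_monoid_rels : {vspace tensor2 k X} :=
  <<[seq basis_tensor k p.1 p.2 - basis_tensor k (phi p).1 (phi p).2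
      | p in P]>>%VS.

Lemma quad_monoid_lift_word (w : {fmonom X}) :
  tens_lift quad_monoid_gen << w >> = << word_class w >>.
Proof.
rewrite tens_lift_word /word_val; case: w => s /=.
elim: s => [|x s IHs]; first by rewrite big_nil.
rewrite big_cons IHs [LHS]fgmulUU mulr1 -[x :: s]cat1s.
by rewrite word_class_cat.
Qed.

Lemma quad_monoid_presented : presented_by quad_monoid_gen quad_monoid_rels.
Proof.
set R := quad_monoid_rels; have [I0 ID IM] := ideal_gen_ideal
  (fun a => exists2 r, r \in R & a = tensor2_embed r).
have IN x : quad_ideal R x -> quad_ideal R (- x).
  by move=> Ix; have := IM (- 1) _ 1 Ix; rewrite mulN1r mulr1.
have IZ c x : quad_ideal R x -> quad_ideal R (c *: x).
  by move=> Ix; have := IM c%:A _ 1 Ix; rewrite mulr1 -scalerAl mul1r.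
have Icong u v : word_cong u v ->
    quad_ideal R ((<< FMonom u >> : tensor_algebra k X) - << FMonom v >>).
  elim=> {u v} [u p v Pp|u|u v _ /IN|v u w _ uv _ vw].
  - pose tp (q : X * X) := tens_gen k q.1 * tens_gen k q.2.
    have tpE q : << FMonom (u ++ [:: q.1; q.2] ++ v) >>
        = << FMonom u >> * tp q * << FMonom v >> :> tensor_algebra k X.
      apply: etrans (tens_cat _ _ _) _; rewrite -(mulrA << FMonom u >>).
      congr (_ * _); apply: etrans (tens_cat _ _ _) _; congr (_ * _).
      by rewrite /tp /tens_gen !fmuE; apply: (tens_cat k [:: q.1] [:: q.2]).
    rewrite !tpE -mulrBl -mulrBr; apply: IM; apply: mem_ideal_gen.
    exists (basis_tensor k p.1 p.2 - basis_tensor k (phi p).1 (phi p).2).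
      by apply/memv_span/imageP; exists p.
    by rewrite linearB /= !tensor2_embed_basis.
  - by rewrite subrr.
  - by rewrite opprB.
  - by have := ID _ _ uv vw; rewrite addrA subrK.
split=> [b|a].
  exists (\sum_(m <- msupp b) b@_m *: << FMonom (repr m) >>).
  rewrite linear_sum [RHS]monalgE; apply: eq_bigr => m _.
  rewrite linearZ /= quad_monoid_lift_word word_class_repr.
  exact: malgZU.
split; last first.
  move/(_ (fun a => tens_lift quad_monoid_gen a = 0)).
  apply=> [|_ [r Rr ->]].
    split=> [|x y x0 y0|x y z y0]; first exact: raddf0.
      by rewrite raddfD /= x0 y0 addr0.
    by rewrite !rmorphM /= y0 mulr0 mul0r.
  rewrite (coord_span Rr) [tensor2_embed _]linear_sum linear_sum big1 // => i _.
  rewrite !linearZ /=.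
  set r' := _`_i; have /imageP[p Pp ->] : r' \in image (fun p =>
      basis_tensor k p.1 p.2 - basis_tensor k (phi p).1 (phi p).2) P.
    by apply: mem_nth; rewrite /= size_tuple.
  rewrite tens_lift_embed_rel.
  have genM x y : quad_monoid_gen x * quad_monoid_gen y
      = << word_class [:: x; y] >>.
    by rewrite [LHS]fgmulUU mulr1 -[[:: x; y]]cat1s word_class_cat.
  have /word_classP /= pE := WordCongRel [::] [::] Pp.
  by rewrite !genM pE subrr scaler0.
pose sec : monoid_algebra k quad_monoid -> tensor_algebra k X :=
  mmap (in_alg (tensor_algebra k X))
    (fun m : quad_monoid => (<< FMonom (repr m) >> : tensor_algebra k X)).
move=> a0; have -> : a = a - sec (tens_lift quad_monoid_gen a).
  by rewrite a0 /sec raddf0 subr0.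
have secE : sec (tens_lift quad_monoid_gen a) =
    \sum_(w <- msupp a) a@_w *: << FMonom (repr (word_class w)) >>.
  rewrite [a in LHS]tens_expand linear_sum /sec raddf_sum /=.
  apply: eq_bigr => w _; rewrite linearZ /= quad_monoid_lift_word.
  have -> : a@_w *: << word_class w >> =
      << a@_w *g word_class w >> :> monoid_algebra k quad_monoid.
    exact: malgZU.
  by rewrite mmapU /= -scalerAl mul1r.
rewrite secE [a in a - _]tens_expand -sumrB.
apply: (big_ind (quad_ideal R)) => // w _.
rewrite -scalerBr; apply: IZ; rewrite -{1}[w]fmK; apply: Icong.
by apply/word_classP; rewrite word_class_repr.
Qed.


End QuadraticMonoid.

Section Coxeter.
Local Open Scope group_scope.
Variable W : finGroupType.
Implicit Types (S A P : {set W}) (c w z : W).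

(* W has the presentation with generators S and relations (st)^m(s,t) = 1,
   where m(s,t) is the order of st. *)
Definition coxeter_system S : Prop :=
  [/\ <<S>> = [set: W],
      {in S, forall s, #[s] = 2%N}
    & forall (H : groupType) (f : W -> H),
        {in S &, forall s t, (f s * f t) ^+ #[s * t] = 1} ->
        exists2 g : W -> H, {morph g : x y / x * y} & {in S, g =1 f}].

Definition standard_coxeter_element S c : Prop :=
  exists2 s : seq W, perm_eq s (enum S) & c = \prod_(x <- s) x.

Definition reflections S : {set W} := class_support S [set: W].

(* [A ^+ n] is the set of products of n elements of A; the default value 0 is
   irrelevant when A generates W. *)
Definition gen_length A w : nat :=
  if pselect (exists n, w \in A ^+ n) is left e then ex_minn e else 0%N.

Definition refl_length S w : nat := gen_length (reflections S) w.

Definition abs_le S w z : bool :=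
  (refl_length S w + refl_length S (w^-1 * z) == refl_length S z)%N.

Definition NC2 S c : {set W} :=
  [set w | abs_le S w c & refl_length S w == 2%N].

Definition refl S := {t : W | t \in reflections S}.

Fact refl_conj_subproof S (t u : refl S) : val t ^ val u \in reflections S.
Proof.
have /imset2P[s g Ss _ ->] := valP t.
by rewrite -conjgM; apply: imset2_f; rewrite ?inE.
Qed.

Definition refl_conj S (t u : refl S) : refl S :=
  exist _ (val t ^ val u) (refl_conj_subproof t u).

Definition rank2_parabolic S P : Prop :=
  exists s t g, [/\ s \in S, t \in S, s != t & P = <<[set s; t]>> :^ g].

(* The simple reflections of the reflection subgroup P with respect to the
   positive system induced by S, in Dyer's description: the reflections t of P
   whose only inversion in P is t itself. *)
Definition simple_reflections S P : {set W} :=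
  [set t in reflections S :&: P
    | [set u in reflections S :&: P | (gen_length S (u * t) < gen_length S t)%N]
      == [set t]].

(* [next us] and [prev us] are the cyclic successor and predecessor in us. *)
Definition dihedral_labelling S P (us : seq (refl S)) : Prop :=
  [/\ uniq us,
      forall t : refl S, (t \in us) = (val t \in P),
      {in us, forall u,
        val (next us u) * val u = val u * val (prev us u)}
    & if us is u1 :: us' then
        val u1 \in simple_reflections S P /\
        val (last u1 us') \in simple_reflections S P
      else False].

(* [lep] is the non-strict version of the order. *)
Definition reflection_ordering S (lep : rel (refl S)) : Prop :=
  [/\ total lep, antisymmetric lep, transitive lep
    & forall P, rank2_parabolic S P ->
      forall us, dihedral_labelling P us -> sorted lep us \/ sorted lep (rev us)].

Definition refl_below S (lep : rel (refl S)) w : seq (refl S) :=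
  sort lep (enum [set t : refl S | abs_le S (val t) w]).

Definition c_compatible S c (lep : rel (refl S)) : Prop :=
  {in NC2 S c, forall w,
    {in refl_below lep w, forall u, w = val u * val (prev (refl_below lep w) u)}}.

Section DualBraid.
Variables (S : {set W}) (c : W).

Definition braid_pairs : pred (refl S * refl S) :=
  [pred p | abs_le S (val p.1 * val p.2) c].
Definition braid_move (p : refl S * refl S) : refl S * refl S :=
  (p.2, refl_conj p.1 p.2).

Definition dual_braid_monoid := quad_monoid braid_pairs braid_move.

Definition dual_braid_algebra (k : fieldType) : quadratic_algebra k :=
  QuadraticAlgebra (quad_monoid_presented braid_pairs braid_move k).

Definition cyclic_rel (k : fieldType) (lep : rel (refl S)) (w : W) :
    tensor2 k (refl S) :=
  (\sum_(u <- refl_below lep w)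
     basis_tensor k u (prev (refl_below lep w) u))%R.

End DualBraid.
End Coxeter.

(* Main.v *)
Require Import Defs.
From mathcomp Require Import all_boot all_order all_fingroup all_algebra.
From mathcomp Require Import boolp.

(** Writing [f] in R^perp as a function on pairs of reflections, orthogonality
    to the relations of the dual braid monoid says that [f] is invariant under
    the Hurwitz move (t, u) |-> (u, t^u) on the pairs with tu <=_T c. The move
    preserves the product tu. It fixes the pairs (t, t), and
    by c-compatibility it permutes cyclically the factorisations
    (u_i, u_{i-1}) of a given w in NC_2. The sign character excludes
    l_T(tu) = 1, so for t <> u and tu <=_T c the product lies in NC_2. Hence
    R^perp is spanned by the indicators of the orbits, which are the elements
    (1), (3), and of the pairs with tu not below c, which are the elements (2). *)

Set Implicit Arguments.
Unset Strict Implicit.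
Unset Printing Implicit Defensive.

Import GRing.Theory.
Local Open Scope ring_scope.

(** * Orthogonality to the relations of a quadratic monoid *)

Section QuadraticPairing.
Variables (k : fieldType) (X : finType).

Lemma basis_tensorE (x y : X) (p : X * X) :
  basis_tensor k x y p = (p == (x, y))%:R.
Proof. by case: p => a b; rewrite !ffunE /= -natrM mulnb. Qed.

Lemma pairing2_basis_tensor (f : tensor2 k X) x y :
  pairing2 f (basis_tensor k x y) = f (x, y).
Proof.
rewrite /pairing2 (bigD1 (x, y)) //= basis_tensorE eqxx mulr1.
rewrite big1 ?addr0 // => p /negPf pxy.
by rewrite basis_tensorE pxy mulr0.
Qed.

(** Pairing with a basis tensor evaluates [f] at that pair of generators, so orthogonality to the
    relation attached to [p] reads [f p - f (phi p) = 0]; by linearity the spanning relations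
    suffice. *)
Lemma mem_perp_quad_monoid_rels (P : {pred X * X}) (phi : X * X -> X * X)
    (f : tensor2 k X) :
  f \in perp (quad_monoid_rels P phi k) <-> {in P, forall p, f p = f (phi p)}.
Proof.
pose pf : {linear tensor2 k X -> k^o} := pairing2 f.
have pairB p : pairing2 f (basis_tensor k p.1 p.2 -
    basis_tensor k (phi p).1 (phi p).2) = f p - f (phi p).
  apply: etrans (linearB pf _ _) _; rewrite /= !pairing2_basis_tensor.
  by case: (phi p) => ? ?; case: p.
rewrite perpP; split=> [fR p Pp|fP r Rr].
  apply/eqP; rewrite -subr_eq0 -pairB; apply/eqP/fR.
  by apply/memv_span/imageP; exists p.
rewrite -[pairing2 f]/(pf : _ -> _) (coord_span Rr) linear_sum big1 // => i _.
rewrite linearZ /=.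
set r' := _`_i; have /imageP[p Pp ->] : r' \in image (fun p =>
    basis_tensor k p.1 p.2 - basis_tensor k (phi p).1 (phi p).2) P.
  by apply: mem_nth; rewrite /= size_tuple.
by rewrite pairB fP // subrr scaler0.
Qed.

End QuadraticPairing.

(** * Reflection length and the sign character *)

Section ReflectionLength.
Local Open Scope group_scope.
Variables (W : finGroupType) (S : {set W}).

Lemma gen_length_eq (A : {set W}) (w : W) n :
  w \in A ^+ n -> (forall m, (m < n)%N -> w \notin A ^+ m) ->
  gen_length A w = n.
Proof.
move=> wn wm; rewrite /gen_length; case: pselect => [e|[]]; last by exists n.
case: ex_minnP => m wAm mmin; apply/eqP; rewrite eqn_leq mmin //= leqNgt.
by apply: contraL wAm => /wm.
Qed.

Lemma refl_length1 : refl_length S 1 = 0%N.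
Proof. by apply: gen_length_eq => //; rewrite expg0 inE. Qed.

Lemma abs_le1 c : abs_le S 1 c.
Proof. by rewrite /abs_le refl_length1 invg1 mul1g. Qed.

Hypothesis coxS : coxeter_system S.

Lemma reflection_involutive t : t \in reflections S -> t * t = 1.
Proof.
case: coxS => _ ord2 _ /imset2P[s g /ord2 s2 _ ->].
by rewrite -conjMg -[s * s]/(s ^+ 2) -s2 expg_order conj1g.
Qed.

(** [{perm bool}] stands for the group of order 2. Sending every element of [S] to the transposition
    respects the Coxeter relations, since the product of any two images is already 1. The target is
    abelian, so conjugates of simple reflections keep the same image. *)
Lemma exists_sign_character : exists g : W -> {perm bool},
  {morph g : x y / x * y} /\ {in reflections S, forall t, g t = tperm true false}.
Proof.
case: coxS => _ _ /(_ {perm bool} (fun=> tperm true false)) [|g gM gS].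
  by move=> s t _ _; rewrite tperm2 expg1n.
have g1 : g 1 = 1 by apply: (mulgI (g 1)); rewrite -gM !mulg1.
have gC x y : g x * g y = g y * g x.
  have permC (p q : {perm bool}) : p * q = q * p.
    (* A permutation of [bool] is the translation by its value at [false], and translations
       commute. *)
    suff pE (r : {perm bool}) b : r b = b (+) r false.
      apply/permP => b; rewrite !permM [q _]pE [p (q b)]pE.
      by rewrite [p b]pE [q b]pE addbAC.
    case: b => //=; have : r true != r false by rewrite (inj_eq perm_inj).
    by case: (r true); case: (r false).
  exact: permC.
exists g; split=> // _ /imset2P[s x Ss _ ->].
rewrite conjgE gM gC -gM -mulgA mulgV mulg1.
exact: gS.
Qed.

Lemma reflection_neq1 t : t \in reflections S -> t != 1.
Proof.
case: exists_sign_character => g [gM gT] Tt; apply/eqP => t1.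
have g1 : g 1 = 1 by apply: (mulgI (g 1)); rewrite -gM !mulg1.
have := gT t Tt; rewrite t1 g1 => /permP/(_ true).
by rewrite perm1 tpermL.
Qed.

Lemma reflection_mul_notin t u :
  t \in reflections S -> u \in reflections S -> t * u \notin reflections S.
Proof.
case: exists_sign_character => g [gM gT] Tt Tu; apply/negP => /gT.
rewrite gM !gT // tperm2 => /permP/(_ true).
by rewrite perm1 tpermL.
Qed.

Lemma refl_length_reflection t : t \in reflections S -> refl_length S t = 1%N.
Proof.
move=> Tt; apply: gen_length_eq => [|[|//] _]; first by rewrite expg1.
by rewrite expg0 inE reflection_neq1.
Qed.

(** Length 0 would give t = u, reflections being involutions; length 1 contradicts the sign. *)
Lemma refl_length_mul t u : t \in reflections S -> u \in reflections S ->
  t != u -> refl_length S (t * u) = 2%N.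
Proof.
move=> Tt Tu tu; apply: gen_length_eq => [|[|[|//]] _].
- by rewrite expgS expg1 mem_mulg.
- rewrite expg0 inE; apply: contra tu => /eqP tu1.
  by apply/eqP/(mulIg u); rewrite tu1 (reflection_involutive Tu).
- by rewrite expg1 reflection_mul_notin.
Qed.

(** Separates the diagonal pairs, whose product 1 has length 0, from the other pairs with product
    below c. *)
Lemma mem_NC2_mul c (t u : refl S) :
  (val t * val u \in NC2 S c) = abs_le S (val t * val u) c && (t != u).
Proof.
rewrite inE; have [->|tu] := eqVneq t u; last first.
  by rewrite refl_length_mul ?(valP t) ?(valP u) ?andbT.
by rewrite reflection_involutive ?(valP u) // refl_length1 !andbF.
Qed.

End ReflectionLength.

(** * Factorisations of elements of [NC2] into two reflections *)

Section CyclicRelation.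
Variables (k : fieldType) (W : finGroupType) (S : {set W}) (c : W).
Variable lep : rel (refl S).
Hypotheses (coxS : coxeter_system S) (ccomp : c_compatible c lep).

Lemma uniq_refl_below w : uniq (refl_below lep w).
Proof. by rewrite sort_uniq enum_uniq. Qed.

Lemma mem_refl_below w t : (t \in refl_below lep w) = abs_le S (val t) w.
Proof. by rewrite mem_sort mem_enum inE. Qed.

(** Both t and t^-1 w = u have length 1, so t lies below w. Then c-compatibility writes w as t times
    the cyclic predecessor of t, and cancelling t identifies u. *)
Lemma mul_refl_below (t u : refl S) w : w \in NC2 S c ->
  (val t * val u)%g = w ->
  t \in refl_below lep w /\ u = prev (refl_below lep w) t.
Proof.
move=> wNC tuw; have tw : t \in refl_below lep w.
  move: (wNC); rewrite inE => /andP[_ /eqP w2].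
  rewrite mem_refl_below /abs_le w2 -tuw mulKg.
  by rewrite !refl_length_reflection ?(valP t) ?(valP u).
split=> //; apply/val_inj/(mulgI (val t)).
by rewrite tuw -(ccomp wNC tw).
Qed.

(** The list below w has no repetition, so each factorisation of w contributes exactly once; by
    c-compatibility no other pair occurs. *)
Lemma cyclic_relE w (p : refl S * refl S) : w \in NC2 S c ->
  cyclic_rel k lep w p = ((val p.1 * val p.2)%g == w)%:R.
Proof.
case: p => t u wNC /=; rewrite /cyclic_rel sum_ffunE.
have [tuw|tuw] := eqVneq.
  have [tw ->] := mul_refl_below wNC tuw.
  rewrite (bigD1_seq t) ?uniq_refl_below //= basis_tensorE eqxx.
  rewrite big1 ?addr0 // => a /negPf ta.
  by rewrite basis_tensorE xpair_eqE eq_sym ta.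
rewrite big_seq big1 // => a aw; rewrite basis_tensorE xpair_eqE.
case: eqP => //= ta; case: eqP => //= ua.
by case/eqP: tuw; rewrite ta ua -(ccomp wNC aw).
Qed.

Lemma val_braid_move (p : refl S * refl S) :
  (val (braid_move p).1 * val (braid_move p).2 = val p.1 * val p.2)%g.
Proof. by case: p => t u /=; rewrite conjgE mulKVg. Qed.

(** The factorisations of w form a single orbit of the Hurwitz move, which runs backwards through
    the cycle [refl_below lep w]. *)
Lemma braid_invariant_mul (f : refl S * refl S -> k) :
  {in @braid_pairs W S c, forall p, f p = f (braid_move p)} ->
  forall p q w, w \in NC2 S c ->
    (val p.1 * val p.2)%g = w -> (val q.1 * val q.2)%g = w -> f p = f q.
Proof.
move=> finv [t u] [t' u'] w wNC /= tuw tuw'.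
have [tw ->] := mul_refl_below wNC tuw.
have [tw' ->] := mul_refl_below wNC tuw'.
set us := refl_below lep w in tw tw' *.
have usU : uniq us := uniq_refl_below w.
(* The move takes (u_{i+1}, u_i) to a pair with first entry u_i and product still w, which must be
   (u_i, u_{i-1}). *)
have step a : a \in us -> f (next us a, prev us (next us a)) = f (a, prev us a).
  move=> aw; have naw : next us a \in us by rewrite mem_next.
  have mulw := ccomp wNC naw.
  rewrite finv ?inE /= -?mulw; last by case/setIdP: wNC.
  congr (f _).
  have [|_] := @mul_refl_below (braid_move (next us a, prev us (next us a))).1
    (braid_move (next us a, prev us (next us a))).2 w wNC.
    by rewrite val_braid_move -mulw.
  by rewrite /braid_move /= => ->; rewrite (prev_next usU).
(* Iterating [next] from t reaches t'; induct on the number of iterations. *)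
have := fconnect_cycle (cycle_next usU) tw t'; rewrite tw' => /iter_findex <-.
elim: (findex _ _ _) => //= n ->; rewrite step //.
by elim: n => //= n IHn; rewrite mem_next.
Qed.

End CyclicRelation.

(** * The spanning set of R^perp *)

Theorem theorem5p1 (k : fieldType) (W : finGroupType) (S : {set W}) (c : W)
    (lep : rel (refl S)) :
  coxeter_system S ->
  standard_coxeter_element S c ->
  reflection_ordering lep ->
  c_compatible c lep ->
  let A := dual_braid_algebra S c k in
  let P := quadratic_dual A in
  let rels : seq (tensor2 k (refl S)) :=
    [seq basis_tensor k t t | t : refl S] ++
    [seq basis_tensor k p.1 p.2
      | p in [pred p : refl S * refl S
              | ~~ abs_le S (val p.1 * val p.2)%g c]] ++
    [seq cyclic_rel k lep w | w in NC2 S c] in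
  perp (qrels A) = <<rels>>%VS /\ presented_by (@qgen k P) <<rels>>%VS.
Proof.
move=> coxS _ _ ccomp A P rels.
(* The dual is by construction the quotient by the orthogonal space, so only the equality of
   subspaces remains. *)
suff perpE : perp (qrels A) = <<rels>>%VS.
  by split=> //; rewrite -perpE; apply: qpresented P.
apply/eqP; rewrite eqEsubv; apply/andP; split; last first.
  apply/span_subvP => r; rewrite !mem_cat => r_rels.
  apply/mem_perp_quad_monoid_rels => p pc.
  case/or3P: r_rels => /imageP[]; last first.
  - by move=> w wNC ->; rewrite !(cyclic_relE k coxS ccomp) // val_braid_move.
  - move=> q; rewrite inE => qc ->.
    (* The move preserves products, so neither p nor its image can be q, whose product is not below
       c. *)
    have neq p' : (val p'.1 * val p'.2)%g = (val p.1 * val p.2)%g ->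
        (p' == (q.1, q.2)) = false.
      move=> p'p; apply/negP => /eqP p'q; move: qc pc.
      by rewrite inE /= -p'p p'q /= => /negPf ->.
    by rewrite !basis_tensorE !neq // val_braid_move.
  - move=> t _ ->; rewrite !basis_tensorE; congr ((nat_of_bool _)%:R).
    case: p {pc} => a b; rewrite /braid_move !xpair_eqE /=.
    rewrite andbC; have [->|] := eqVneq b t; rewrite ?andbF ?andbT //.
    (* With b = t, the conjugate of a by t equals t only if a = t. *)
    rewrite -!val_eqE /=; apply/eqP/eqP => [->|abt]; first by rewrite conjgE mulKg.
    by apply: (conjg_inj (val t)); rewrite abt conjgE mulKg.
apply/subvP => f /mem_perp_quad_monoid_rels finv.
(* The value of f at some factorisation of w, and 0 if there is none; for w in [NC2], invariance
   makes the choice irrelevant. *)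
pose F w := if [pick p | (val p.1 * val p.2)%g == w :> W] is Some p
            then f p else 0.
have -> : f = \sum_(t : refl S) f (t, t) *: basis_tensor k t t
    + \sum_(p : refl S * refl S | ~~ abs_le S (val p.1 * val p.2)%g c)
        f p *: basis_tensor k p.1 p.2
    + \sum_(w in NC2 S c) F w *: cyclic_rel k lep w.
  apply/ffunP => -[t u]; rewrite !ffunE !sum_ffunE.
  under eq_bigr => a _ do rewrite ffunE basis_tensorE.
  under [X in _ + X + _]eq_bigr => p _ do rewrite ffunE basis_tensorE.
  under [X in _ + _ + X]eq_bigr => w wNC
    do rewrite ffunE (cyclic_relE k coxS ccomp) //=.
  (* At (t, t) only family (1) contributes: the product 1 is below c and has length 0, which rules
     out (2) and (3). *)
  have [diag|offdiag] := eqVneq t u.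
    have tu1 : (val t * val u = 1)%g.
      by rewrite diag (reflection_involutive coxS) ?(valP u).
    rewrite (bigD1 t) //= -diag eqxx big1 => [|a /negPf at_]; last first.
      by rewrite xpair_eqE eq_sym at_ [LHS]mulr0.
    rewrite big1 => [|p pc]; last first.
      case: eqP => [tp|_]; last exact: mulr0.
      by case/negP: pc; case: p tp => a b [<- <-] /=; rewrite {2}diag tu1 abs_le1.
    rewrite big1 => [|w wNC]; last first.
      case: eqP => [tw|_]; last exact: mulr0.
      by move: wNC; rewrite -tw (mem_NC2_mul coxS) eqxx andbF.
    by rewrite !addr0 [RHS]mulr1.
  rewrite [X in X + _ + _]big1 => [|a _]; last first.
    rewrite xpair_eqE; case: eqP => [<-|_]; last exact: mulr0.
    by rewrite eq_sym (negPf offdiag) [LHS]mulr0.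
  (* Off the diagonal, only the term w = tu of (3) survives if tu is below c, and only the term (t,
     u) of (2) otherwise. *)
  rewrite add0r; have [tuc|tuc] := boolP (abs_le S (val t * val u)%g c).
    have tuNC : (val t * val u)%g \in NC2 S c.
      by rewrite (mem_NC2_mul coxS) tuc.
    rewrite big1 => [|p pc]; last first.
      case: eqP => [tp|_]; last exact: mulr0.
      by case/negP: pc; case: p tp => a b [<- <-].
    rewrite add0r (bigD1 (val t * val u)%g) //= eqxx.
    rewrite big1 => [|w /andP[_ /negPf wtu]]; last first.
      by rewrite eq_sym wtu [LHS]mulr0.
    rewrite addr0 [RHS]mulr1 /F; case: pickP => [p /eqP ptu|/(_ (t, u))].
      exact: (braid_invariant_mul coxS ccomp finv tuNC).
    by rewrite eqxx.
  rewrite (bigD1 (t, u)) //= eqxx big1 => [|[a b] /andP[_ /negPf ab]]; last first.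
    by rewrite /= eq_sym ab [LHS]mulr0.
  rewrite big1 => [|w wNC]; first by rewrite !addr0 [RHS]mulr1.
  case: eqP => [tw|_]; last exact: mulr0.
  by move: wNC; rewrite -tw inE (negPf tuc).
apply: memvD; first apply: memvD.
- apply: memv_suml => t _; apply/memvZ/memv_span.
  by rewrite mem_cat; apply/orP; left; apply/imageP; exists t.
- apply: memv_suml => p pc; apply/memvZ/memv_span.
  by rewrite !mem_cat; apply/or3P/Or32/imageP; exists p.
- apply: memv_suml => w wNC; apply/memvZ/memv_span.
  by rewrite !mem_cat; apply/or3P/Or33/imageP; exists w.
Qed.
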